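(* Let $N$ be a positive integer and let $\mathcal{L}\subseteq\mathbb{R}^{N}$ be a tame lattice, with vector $v_1\in\mathcal{L}\cap\mathcal{L}^{*}$ and Lagrangian basis $\{e_1,\dots,e_N\}$. Let $r,s$ be integers such that $0\neq |r|<N$ and let $m:=r+sN$. Let $a:=\langle e_1,e_1\rangle$ and $h:=-\langle e_1,e_2\rangle$. Suppose that $$\frac{Na-1}{N^2-1}\leq \left(\frac{m}{r}\right)^2\leq \frac{(aN-1)(N+1)}{N-1}.$$ Then the lattice $\mathcal{L}_{v_1}^{(r,s)}$ is a sub-lattice of $\mathcal{L}$ of index $|m|\,|r|^{N-1}$, with minimum $$\lambda_1(\mathcal{L}_{v_1}^{(r,s)})=ar^2+\frac{m^2-r^2}{N},$$ and with basis of minimal vectors $$\{re_1+sv_1,\ re_2+sv_1,\ \dots,\ re_N+sv_1\}.$$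
   Context: $\langle\cdot,\cdot\rangle$ is the standard inner product on $\mathbb{R}^N$ and $\|\cdot\|$ its norm. Lattices in $\mathbb{R}^N$ are full rank. $\mathcal{L}^{*}=\{y\in\mathbb{R}^N:\langle x,y\rangle\in\mathbb{Z}\ \forall x\in\mathcal{L}\}$ is the dual lattice. Tame lattice: a rank $N$ lattice $\mathcal{L}\subseteq\mathbb{R}^N$ is tame if there are a $\mathbb{Z}$-basis $\{e_1,\dots,e_N\}$ of $\mathcal{L}$ and a non-zero $v_1\in\mathcal{L}\cap\mathcal{L}^{*}$ such that (1) $e_1+\dots+e_N=v_1$; (2) $\langle e_i,v_1\rangle=1$ for all $i$; (3) $\langle e_i,e_i\rangle=\langle e_j,e_j\rangle$ for all $i,j$; (4) $\langle e_i,e_j\rangle=\langle e_k,e_l\rangle$ whenever $i\neq j$ and $k\neq l$. Such a basis is called a Lagrangian basis. For integers $r,s$, let $\Phi_{(r,s)}:\mathcal{L}\to\mathcal{L}$, $\Phi_{(r,s)}(x)=rx+s\langle x,v_1\rangle v_1$, and $\mathcal{L}_{v_1}^{(r,s)}:=\Phi_{(r,s)}(\mathcal{L})$. For a lattice $\Lambda$, the minimum is $\lambda_1(\Lambda)=\min_{x\in\Lambda\setminus\{0\}}\|x\|^2$ (the squared norm), and minimal vectors are the $x\in\Lambda$ with $\|x\|^2=\lambda_1(\Lambda)$. A basis of minimal vectors is a $\mathbb{Z}$-basis of $\Lambda$ consisting of minimal vectors. *)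

(* Defs.v *)
From HB Require Import structures.
From mathcomp Require Export all_boot all_order all_algebra.
From mathcomp Require Export boolp classical_sets functions cardinality reals.

Set Implicit Arguments.
Unset Strict Implicit.
Unset Printing Implicit Defensive.

Import Order.TTheory GRing.Theory Num.Theory.

Local Open Scope classical_set_scope.
Local Open Scope ring_scope.

Section Lattices.
Variables (R : realType) (N : nat).
Implicit Types (L M : set 'rV[R]_N) (x y v : 'rV[R]_N) (b e : N.-tuple 'rV[R]_N).

(* The norm that the libraries put on 'rV[R]_N is the sup norm, so the squared
   Euclidean norm of x is always written dot x x. *)
Definition dot x y : R := \sum_(i < N) x 0 i * y 0 i.

(* A full-rank lattice: the Z-span of a basis of the real vector space R^N. *)
Definition lattice L : Prop :=
  exists b, basis_of fullv b /\ L = [set x | inIntSpan b x].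

Definition dual L : set 'rV[R]_N :=
  [set y | forall x, L x -> dot x y \is a Num.int].

Definition zfree b : Prop :=
  forall c : 'I_N -> int, \sum_i tnth b i *~ c i = 0 -> forall i, c i = 0.

Definition zbasis L b : Prop := zfree b /\ L = [set x | inIntSpan b x].

Record lagrangian_basis L v e : Prop := LagrangianBasis {
  lagrangian_zbasis : zbasis L e;
  lagrangian_neq0 : v != 0;
  lagrangian_mem : L v;
  lagrangian_dual : dual L v;
  lagrangian_sum : \sum_i tnth e i = v;
  lagrangian_dot1 : forall i, dot (tnth e i) v = 1;
  lagrangian_diag : forall i j,
    dot (tnth e i) (tnth e i) = dot (tnth e j) (tnth e j);
  lagrangian_offdiag : forall i j k l, i != j -> k != l ->
    dot (tnth e i) (tnth e j) = dot (tnth e k) (tnth e l)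
}.

Definition tame L : Prop := lattice L /\ exists v e, lagrangian_basis L v e.

Definition Phi v (r s : int) x : 'rV[R]_N :=
  x *~ r + (s%:~R * dot x v) *: v.

Definition sublattice_rs L v (r s : int) : set 'rV[R]_N := Phi v r s @` L.

(* The quotient L / M, as the set of cosets x + M with x in L. *)
Definition cosets L M : set (set 'rV[R]_N) :=
  [set [set x + y | y in M] | x in L].

Definition has_index L M (k : nat) : Prop := (cosets L M #= `I_k)%card.

Definition sublattice M L : Prop := lattice M /\ M `<=` L.

Definition sqnorms L : set R := [set dot x x | x in L `\ 0].

(* "lambda_1(L) = l": l is the least element of the set of squared norms of the
   nonzero vectors of L (attained, not just an infimum). *)
Definition is_lambda1 L (l : R) : Prop := sqnorms L l /\ lbound (sqnorms L) l.

Definition minimal_vector L x : Prop := L x /\ is_lambda1 L (dot x x).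

Definition basis_of_minimal_vectors L b : Prop :=
  zbasis L b /\ forall i, minimal_vector L (tnth b i).

End Lattices.

(* Main.v *)
(* Put A = a + h. In coordinates x = sum y_i e_i, with S = sum y_i^2 and
   t = sum y_i, the Gram matrix of the Lagrangian basis gives
   N |Phi x|^2 = r^2 A (N S - t^2) + m^2 t^2, and the two hypotheses say that
   r^2 A <= (N + 1) m^2 and m^2 <= (N + 1) r^2 A. The minimum over nonzero
   integer vectors then follows from S >= 2 when t = 0, and from
   t^2 - 1 <= (N + 1) (S - 1) otherwise, a consequence of t^2 <= N S and
   |t| <= S. For the index, replacing the coordinates y by t and the y_i of
   index i > 0 makes Phi block triangular with diagonal m, r, .., r. *)
Require Import Defs.
From mathcomp Require Import ring lra zify.

Import Order.TTheory GRing.Theory Num.Theory.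

Local Open Scope ring_scope.

(** * Integer vectors: bounds on sums of squares, and the cokernel of [phi_coord] *)

Section IntegerVectors.

(** The sum and the later entries are triangular coordinates; an identity checked in them needs no
    computation at index 0. *)
Lemma eq_lift0_sum {V : zmodType} {n : nat} (f g : 'I_n.+1 -> V) :
    (forall j, f (lift ord0 j) = g (lift ord0 j)) ->
  \sum_i f i = \sum_i g i -> f =1 g.
Proof.
move=> fg; rewrite !big_ord_recl (eq_bigr _ (fun j _ => fg j)) => /addIr fg0 i.
by case: (unliftP ord0 i) => [j|] ->.
Qed.

(** Two residues in [0, |m|) differ by less than |m|. *)
Lemma ord_absz_inj {m k : int} (a b : 'I_`|m|) :
  a%:Z - b%:Z = m * k -> k = 0 /\ a = b.
Proof.
move=> abE; have ltam := ltn_ord a; have ltbm := ltn_ord b.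
have k0 : k = 0 by nia.
by split=> //; apply: val_inj => /=; move: abE; rewrite k0; lia.
Qed.

(** Cauchy-Schwarz against the all-ones vector: the squares of [n * x i - t] add up to n (n S -
    t^2). *)
Lemma sqr_sum_le_sum_sqr {n : nat} (x : 'I_n -> int) :
  (\sum_i x i) ^+ 2 <= n%:Z * \sum_i x i ^+ 2.
Proof.
case: n x => [|n] x; first by rewrite !big_ord0.
set t := \sum_i x i; set S := \sum_i x i ^+ 2.
have : 0 <= \sum_i (n.+1%:Z * x i - t) ^+ 2.
  by apply: sumr_ge0 => i _; rewrite sqr_ge0.
have -> : \sum_i (n.+1%:Z * x i - t) ^+ 2 = n.+1%:Z * (n.+1%:Z * S - t ^+ 2).
  transitivity (\sum_i (n.+1%:Z ^+ 2 * x i ^+ 2 - 2 * n.+1%:Z * t * x i + t ^+ 2)).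
    by apply: eq_bigr => i _; ring.
  rewrite big_split sumrB /= -!mulr_sumr sumr_const card_ord -/t -/S.
  rewrite -mulr_natr; ring.
by rewrite pmulr_rge0 // subr_ge0.
Qed.

Lemma normz_le_sqr (x : int) : `|x| <= x ^+ 2.
Proof. by rewrite expr2; case: (ger0P x); nia. Qed.

Lemma norm_sum_le_sum_sqr {n : nat} (x : 'I_n -> int) :
  `|\sum_i x i| <= \sum_i x i ^+ 2.
Proof.
apply: le_trans (ler_norm_sum _ _ _) _; apply: ler_sum => i _.
exact: normz_le_sqr.
Qed.

Lemma sum_sqr_ge1 {n : nat} (x : 'I_n -> int) (i : 'I_n) :
  x i != 0 -> 1 <= \sum_i x i ^+ 2.
Proof.
move=> xi0; rewrite (bigD1 i) //=.
have : 0 <= \sum_(j < n | j != i) x j ^+ 2.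
  by apply: sumr_ge0 => j _; exact: sqr_ge0.
by move: (normz_le_sqr (x i)); move: (\sum_(j < n | j != i) x j ^+ 2) => u; lia.
Qed.

(** The other coordinates add up to [- x i], so their squares contribute at least |x i| >= 1 as
    well. *)
Lemma sum_sqr_ge2 {n : nat} (x : 'I_n -> int) (i : 'I_n) :
  x i != 0 -> \sum_i x i = 0 -> 2 <= \sum_i x i ^+ 2.
Proof.
move=> xi0; rewrite (bigD1 i) //= [X in _ <= X](bigD1 i) //=.
have : `|\sum_(j < n | j != i) x j| <= \sum_(j < n | j != i) x j ^+ 2.
  apply: le_trans (ler_norm_sum _ _ _) _; apply: ler_sum => j _.
  exact: normz_le_sqr.
move: (\sum_(j < n | j != i) x j) (\sum_(j < n | j != i) x j ^+ 2) => T u.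
by have := normz_le_sqr (x i); lia.
Qed.

Lemma sqr_sum_sub1_le {n : nat} (x : 'I_n -> int) (i : 'I_n) : x i != 0 ->
  (\sum_i x i) ^+ 2 - 1 <= (n%:Z + 1) * (\sum_i x i ^+ 2 - 1).
Proof.
move=> /sum_sqr_ge1; move: (sqr_sum_le_sum_sqr x) (norm_sum_le_sum_sqr x).
move: (\sum_i x i) (\sum_i x i ^+ 2) => t S tNS tS S1.
(* If S > n, then (n + 1)(S - 1) - (n S - 1) = S - n > 0 and t^2 <= n S suffices. If S <= n, then
   t^2 - 1 <= (S + 1)(S - 1) <= (n + 1)(S - 1). *)
have [leSN|ltNS] := lerP S n%:Z; last by nia.
have : t ^+ 2 <= S ^+ 2 by nia.
by nia.
Qed.

(* The vectors with coordinate sum [t.1] and later coordinates [t.2] represent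
   the cokernel of [phi_coord], by block triangularity. *)
Definition coset_rep {n p q : nat} (t : 'I_p * {ffun 'I_n -> 'I_q})
    (i : 'I_n.+1) : int :=
  if unlift ord0 i is Some j then t.2 j : int
  else t.1%:Z - \sum_j (t.2 j)%:Z.

Lemma coset_rep_lift {n p q : nat} (t : 'I_p * {ffun 'I_n -> 'I_q}) j :
  coset_rep t (lift ord0 j) = t.2 j.
Proof. by rewrite /coset_rep liftK. Qed.

Lemma sum_coset_rep {n p q : nat} (t : 'I_p * {ffun 'I_n -> 'I_q}) :
  \sum_i coset_rep t i = t.1.
Proof.
rewrite big_ord_recl {1}/coset_rep unlift_none.
by rewrite (eq_bigr _ (fun j _ => coset_rep_lift t j)) subrK.
Qed.

(** The map Phi in Lagrangian coordinates, where the inner product with v is the coordinate sum. *)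
Definition phi_coord {n : nat} (r s : int) (z : 'I_n -> int) (i : 'I_n) : int :=
  r * z i + s * \sum_j z j.

Lemma sum_phi_coord {n : nat} (r s : int) (z : 'I_n -> int) :
  \sum_i phi_coord r s z i = (r + s * n%:Z) * \sum_i z i.
Proof.
rewrite big_split /= -mulr_sumr sumr_const card_ord -mulr_natr natz; ring.
Qed.

(** Summing the equations gives m times the sum of [z], so that sum vanishes and only [r * z i = 0]
    remains. *)
Lemma phi_coord_inj0 {n : nat} (r s : int) (z : 'I_n -> int) :
    r != 0 -> r + s * n%:Z != 0 ->
  (forall i, phi_coord r s z i = 0) -> forall i, z i = 0.
Proof.
move=> r0 m0 z0 i.
have /eqP : \sum_i phi_coord r s z i = 0 by rewrite big1.
rewrite sum_phi_coord mulf_eq0 (negPf m0) /= => /eqP Z0.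
move: (z0 i) => /eqP; rewrite /phi_coord Z0 mulr0 addr0 mulf_eq0 (negPf r0).
by move/eqP.
Qed.

(** Two rounds of Euclidean division: the sum of [y] by m, with quotient k, then each later
    [y j - s * k] by r. *)
Lemma coset_rep_exists {n : nat} {r s m : int} : r != 0 -> m != 0 ->
    m = r + s * n.+1%:Z -> forall y : 'I_n.+1 -> int,
  exists (t : 'I_`|m| * {ffun 'I_n -> 'I_`|r|}) z,
    forall i, y i = coset_rep t i + phi_coord r s z i.
Proof.
move=> r0 m0 mE y.
have modE (d k : int) : d != 0 -> exists a : 'I_`|d|, a%:Z = (k %% d)%Z.
  move=> d0; have lt_d : (`|(k %% d)%Z| < `|d|)%N.
    have := ltz_mod k d0; have := modz_ge0 k d0; lia.
  by exists (Ordinal lt_d); rewrite /= gez0_abs ?modz_ge0.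
pose k := ((\sum_i y i) %/ m)%Z.
have [c cE] := modE m (\sum_i y i) m0.
have [d dE] := fin_all_exists (fun j => modE r (y (lift ord0 j) - s * k) r0).
pose w j := ((y (lift ord0 j) - s * k) %/ r)%Z.
(* Entry 0 is chosen so that [z] has sum k, as the first division requires. *)
pose z i := if unlift ord0 i is Some j then w j else k - \sum_j w j.
have zlift j : z (lift ord0 j) = w j by rewrite /z liftK.
have sumz : \sum_i z i = k.
  rewrite big_ord_recl (eq_bigr _ (fun j _ => zlift j)).
  by rewrite /z unlift_none subrK.
exists (c, [ffun j => d j]), z; apply: eq_lift0_sum => [j|].
  rewrite coset_rep_lift /phi_coord sumz zlift /= ffunE dE.
  by have := divz_eq (y (lift ord0 j) - s * k) r; rewrite -/(w j); lia.
rewrite big_split /= sum_coset_rep sum_phi_coord -mE sumz /= cE.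
by rewrite addrC mulrC -divz_eq.
Qed.

(** Comparing sums modulo m makes the sum of [z] zero; the later coordinates then differ by
    multiples of r. *)
Lemma coset_rep_inj {n : nat} {r s m : int} : m != 0 ->
    m = r + s * n.+1%:Z -> forall t t' : 'I_`|m| * {ffun 'I_n -> 'I_`|r|},
    forall z, (forall i, coset_rep t i = coset_rep t' i + phi_coord r s z i) ->
  t = t'.
Proof.
move=> m0 mE [c d] [c' d'] z tt'.
have : \sum_i coset_rep (c, d) i
     = \sum_i (coset_rep (c', d') i + phi_coord r s z i) by apply: eq_bigr.
rewrite big_split /= !sum_coset_rep sum_phi_coord -mE /= => ccE.
have [] := @ord_absz_inj m (\sum_i z i) c c'; first by rewrite ccE; ring.
move=> Z0 ->; congr (_, _); apply/ffunP => j.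
have := tt' (lift ord0 j); rewrite !coset_rep_lift /phi_coord Z0 /= => dE.
by have [] := @ord_absz_inj r (z (lift ord0 j)) (d j) (d' j); rewrite ?dE //; ring.
Qed.

End IntegerVectors.

(** * Index from a system of representatives *)

Local Open Scope classical_set_scope.

Lemma has_index_of_reps {R : realType} {N : nat} (L M : set 'rV[R]_N)
    (T : finType) (rep : T -> 'rV[R]_N) :
    M 0 -> (forall x y, M x -> M y -> M (x - y)) -> (forall t, L (rep t)) ->
    (forall x, L x -> exists t, M (x - rep t)) ->
    (forall t t', M (rep t - rep t') -> t = t') ->
  has_index L M #|T|.
Proof.
move=> M0 MB Lrep rep_ex rep_inj.
pose coset x := [set x + y | y in M].
have sub_coset x y : M (x - y) -> coset x `<=` coset y.
  (* The shift is forced by x + w = y + (w - (y - x)). *)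
  move=> Mxy _ [w Mw <-]; exists (w - (y - x)); last first.
    by rewrite opprB addrCA [y + _]addrC subrK addrC.
  by apply: (MB) => //; rewrite -opprB -sub0r; apply: (MB).
have coset_inj x y : coset x = coset y -> M (x - y).
  move=> xy; have : coset x x by exists 0; rewrite ?addr0.
  by rewrite xy => -[w Mw <-]; rewrite addrAC subrr add0r.
have cosetE x y : M (x - y) -> coset x = coset y.
  move=> Mxy; apply/seteqP; split; apply: sub_coset => //.
  by rewrite -opprB -sub0r; apply: (MB).
pose F (k : 'I_#|T|) := coset (rep (enum_val k)).
rewrite /has_index; have -> : cosets L M = [set F k | k in setT].
  apply/seteqP; split=> [_ [x /rep_ex[t Mxt] <-]|_ [k _ <-]].
    by exists (enum_rank t) => //; rewrite /F enum_rankK; apply/esym/cosetE.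
  by exists (rep (enum_val k)).
apply: (card_eq_trans (inj_card_eq _)) (card_esym card_II) => k l _ _.
by move=> /coset_inj/rep_inj/enum_val_inj.
Qed.

(** * Inner product and integer combinations *)

Section Combinations.
Context {R : realType} {N : nat}.
Implicit Types (L : set 'rV[R]_N) (v w x : 'rV[R]_N) (e : N.-tuple 'rV[R]_N).

Lemma dotC x w : dot x w = dot w x.
Proof. by apply: eq_bigr => i _; rewrite mulrC. Qed.

Lemma dotDl x w v : dot (x + w) v = dot x v + dot w v.
Proof. by rewrite -big_split; apply: eq_bigr => i _; rewrite mxE mulrDl. Qed.

Lemma dotZl (c : R) x v : dot (c *: x) v = c * dot x v.
Proof. by rewrite mulr_sumr; apply: eq_bigr => i _; rewrite mxE mulrA. Qed.

Lemma dotZr (c : R) x v : dot x (c *: v) = c * dot x v.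
Proof. by rewrite dotC dotZl dotC. Qed.

Lemma dotDr x w v : dot v (x + w) = dot v x + dot v w.
Proof. by rewrite dotC dotDl !(dotC v). Qed.

Lemma dot_suml {I : finType} (F : I -> 'rV[R]_N) v :
  dot (\sum_i F i) v = \sum_i dot (F i) v.
Proof.
apply: (big_morph (fun x => dot x v)) => [x w|]; first exact: dotDl.
by rewrite /dot big1 // => i _; rewrite mxE mul0r.
Qed.

Lemma dot_sumr {I : finType} (F : I -> 'rV[R]_N) v :
  dot v (\sum_i F i) = \sum_i dot v (F i).
Proof. by rewrite dotC dot_suml; apply: eq_bigr => i _; rewrite dotC. Qed.

(** Coefficients are plain functions, unlike those of [inIntSpan], so that [phi_coord] and
    [coset_rep] apply directly. *)
Definition comb e (y : 'I_N -> int) : 'rV[R]_N := \sum_i tnth e i *~ y i.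

Lemma inIntSpanE e : [set x | inIntSpan e x] = [set comb e y | y in setT].
Proof.
apply/seteqP; split=> x /= [y].
  move=> ->; exists y => //; apply: eq_bigr => i _; congr (_ *~ _).
  exact: tnth_nth.
move=> _ <-; exists [ffun i => y i]; apply: eq_bigr => i _.
by rewrite ffunE (tnth_nth 0).
Qed.

Lemma combB e (y z : 'I_N -> int) :
  comb e y - comb e z = comb e (fun i => y i - z i).
Proof.
by rewrite -sumrB; apply: eq_bigr => i _; rewrite mulrzBr.
Qed.

Lemma eq_comb e (y z : 'I_N -> int) : y =1 z -> comb e y = comb e z.
Proof. by move=> yz; apply: eq_bigr => i _; rewrite yz. Qed.

Lemma comb_inj e (y z : 'I_N -> int) :
  zfree e -> comb e y = comb e z -> y =1 z.
Proof.
move=> freee yz i; apply/eqP; rewrite -subr_eq0; apply/eqP.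
by apply: (freee (fun i => y i - z i)); rewrite -[LHS]combB yz subrr.
Qed.

Lemma comb_delta e i : comb e (fun j => (j == i)%:Z) = tnth e i.
Proof.
rewrite /comb (bigD1 i) //= eqxx mulr1z big1 ?addr0 // => j /negPf ->.
by rewrite mulr0z.
Qed.

Lemma comb_span e (y : 'I_N -> int) : comb e y \in <<e>>%VS.
Proof.
apply: memv_suml => i _; rewrite -scaler_int memvZ //.
by rewrite memv_span // mem_tnth.
Qed.

(** The real span of [e] contains a real basis lying in L, and N vectors spanning an N-dimensional
    space form a basis. *)
Lemma zspan_basis e L : lattice L -> L `<=` [set x | inIntSpan e x] ->
  basis_of fullv e.
Proof.
move=> [b [/span_basis bfull ->]] sub.
rewrite basisEdim size_tuple dimvf /dim /= mul1n leqnn andbT -bfull.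
apply/span_subvP => _ /tnthP[i ->].
have : [set x | inIntSpan e x] (tnth b i).
  by apply: sub; rewrite inIntSpanE; exists (fun j => (j == i)%:Z);
    rewrite ?comb_delta.
by rewrite inIntSpanE => -[y _ <-]; apply: comb_span.
Qed.

(** The images of the [e] vectors under Phi, since each has inner product 1 with v. *)
Definition phi_basis e v (r s : int) : N.-tuple 'rV[R]_N :=
  [tuple tnth e i *~ r + v *~ s | i < N].

(** * Phi and the Gram form in a Lagrangian basis *)

Section Lagrangian.
Context {L : set 'rV[R]_N} {v : 'rV[R]_N} {e : N.-tuple 'rV[R]_N}.
Hypothesis lagr_e : lagrangian_basis L v e.

Let freee : zfree e := (lagrangian_zbasis lagr_e).1.

Lemma lagrangian_comb : L = [set comb e y | y in setT].
Proof. by rewrite (lagrangian_zbasis lagr_e).2 inIntSpanE. Qed.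

Lemma dot_comb_lagrangian (y : 'I_N -> int) :
  dot (comb e y) v = (\sum_i y i)%:~R.
Proof.
rewrite dot_suml rmorph_sum; apply: eq_bigr => i _ /=.
by rewrite -scaler_int dotZl (lagrangian_dot1 lagr_e) mulr1.
Qed.

Lemma Phi_comb (r s : int) (y : 'I_N -> int) :
  Phi v r s (comb e y) = comb e (phi_coord r s y).
Proof.
rewrite /Phi dot_comb_lagrangian -intrM scaler_int -(lagrangian_sum lagr_e).
rewrite !mulrz_suml -big_split; apply: eq_bigr => i _ /=.
by rewrite mulrzDr -!mulrzA (mulrC (y i)).
Qed.

Lemma comb_phi_basis (r s : int) (y : 'I_N -> int) :
  comb (phi_basis e v r s) y = Phi v r s (comb e y).
Proof.
rewrite /Phi dot_comb_lagrangian -intrM scaler_int mulrzA.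
rewrite /comb mulrz_suml mulrz_sumr -big_split.
apply: eq_bigr => i _ /=; rewrite tnth_mktuple.
by rewrite mulrzDl -!mulrzA (mulrC r).
Qed.

Lemma dot_vv_lagrangian : dot v v = N%:R.
Proof.
rewrite -{1}(lagrangian_sum lagr_e) dot_suml.
under eq_bigr do rewrite (lagrangian_dot1 lagr_e).
by rewrite sumr_const card_ord.
Qed.

Lemma sublattice_rsE (r s : int) :
  sublattice_rs L v r s = [set x | inIntSpan (phi_basis e v r s) x].
Proof.
rewrite inIntSpanE /sublattice_rs lagrangian_comb.
apply/seteqP; split=> [_ [_ [y _ <-] <-]|_ [y _ <-]].
  by exists y; rewrite ?comb_phi_basis.
by rewrite comb_phi_basis; exists (comb e y) => //; exists y.
Qed.

Lemma sublattice_rs_sub (r s : int) : sublattice_rs L v r s `<=` L.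
Proof.
move=> w [x]; rewrite lagrangian_comb => -[y _ <-] <-.
by rewrite Phi_comb; exists (phi_coord r s y).
Qed.

Lemma zfree_phi_basis (r s : int) :
  r != 0 -> r + s * N%:Z != 0 -> zfree (phi_basis e v r s).
Proof.
move=> r0 m0 y y0.
have {}y0 : comb e (phi_coord r s y) = 0 by rewrite -Phi_comb -comb_phi_basis.
by apply: (phi_coord_inj0 _ _ _ r0 m0); apply: freee.
Qed.

Lemma basis_of_phi_basis (r s : int) : lattice L ->
  r != 0 -> r + s * N%:Z != 0 -> basis_of fullv (phi_basis e v r s).
Proof.
move=> latL r0 m0; set b := phi_basis e v r s.
have /span_basis efull : basis_of fullv e.
  by apply: (zspan_basis e L latL); rewrite (lagrangian_zbasis lagr_e).2.
rewrite basisEdim size_tuple dimvf /dim /= mul1n leqnn andbT -efull.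
have divz (k : int) x : k != 0 -> x *~ k \in <<b>>%VS -> x \in <<b>>%VS.
  move=> k0; rewrite -scaler_int => /(memvZ k%:~R^-1).
  by rewrite scalerA mulVf ?scale1r // intr_eq0.
have bi i : tnth e i *~ r + v *~ s \in <<b>>%VS.
  rewrite -[_ + _](tnth_mktuple (fun j => tnth e j *~ r + v *~ s)).
  by rewrite memv_span ?mem_tnth.
(* The vectors of [b] add up to m v, and m is invertible in R; each e_i is then recovered by
   subtracting s v and dividing by r. *)
have vb : v \in <<b>>%VS.
  apply: (divz _ _ m0).
  have : \sum_i (tnth e i *~ r + v *~ s) \in <<b>>%VS by apply: memv_suml.
  rewrite big_split /= -mulrz_suml (lagrangian_sum lagr_e) sumr_const card_ord.
  by rewrite mulrzDr mulrzA -pmulrn.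
apply/span_subvP => _ /tnthP[i ->]; apply: (divz _ _ r0).
rewrite -[_ *~ r](addrK (v *~ s)) memvB //.
by rewrite -scaler_int memvZ.
Qed.

Context {a h : R}.
Hypothesis diag : forall i, dot (tnth e i) (tnth e i) = a.
Hypothesis offdiag : forall i j, i != j -> dot (tnth e i) (tnth e j) = - h.

(** The Gram matrix is (a + h) I - h J, with J the all-ones matrix. *)
Lemma dot_basis_comb i (y : 'I_N -> int) :
  dot (tnth e i) (comb e y) = (a + h) * (y i)%:~R - h * (\sum_j y j)%:~R.
Proof.
rewrite dot_sumr (bigD1 i) //= [in RHS](bigD1 i) //= rmorphD rmorph_sum /=.
rewrite -scaler_int dotZr diag.
have -> : \sum_(j < N | j != i) dot (tnth e i) (tnth e j *~ y j)
        = - h * \sum_(j < N | j != i) (y j)%:~R.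
  rewrite mulr_sumr; apply: eq_bigr => j ji.
  by rewrite -scaler_int dotZr offdiag 1?eq_sym // mulrC.
by ring.
Qed.

(** This is <e_i, v> = 1 with v expanded as the all-ones combination; the index argument witnesses N
    > 0. *)
Lemma gram_lagrangian : 'I_N -> a + h - h * N%:R = 1.
Proof.
move=> i; have := dot_basis_comb i (fun=> 1).
rewrite {1}/comb; under eq_bigr do rewrite mulr1z.
rewrite (lagrangian_sum lagr_e) (lagrangian_dot1 lagr_e) mulr1 => yE.
by rewrite [RHS]yE sumr_const card_ord rmorph_nat.
Qed.

Lemma dot_comb (y : 'I_N -> int) :
  dot (comb e y) (comb e y)
    = (a + h) * (\sum_i y i ^+ 2)%:~R - h * (\sum_i y i)%:~R ^+ 2.
Proof.
rewrite {1}/comb dot_suml.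
transitivity (\sum_i ((a + h) * (y i ^+ 2)%:~R
                      - h * (\sum_j y j)%:~R * (y i)%:~R)).
  apply: eq_bigr => i _; rewrite -scaler_int dotZl dot_basis_comb rmorphXn /=.
  by ring.
by rewrite sumrB -!mulr_sumr -!rmorph_sum /= -mulrA.
Qed.

Lemma dot_Phi (r s : int) (x : 'rV[R]_N) :
  dot (Phi v r s x) (Phi v r s x) = r%:~R ^+ 2 * dot x x
    + (2 * r%:~R * s%:~R + s%:~R ^+ 2 * N%:R) * dot x v ^+ 2.
Proof.
rewrite /Phi -scaler_int !(dotDl, dotDr, dotZl, dotZr) (dotC v x).
by rewrite dot_vv_lagrangian; ring.
Qed.

(** Phi scales the line of v by m and its orthogonal complement by r; the two terms are these
    components, multiplied by N to avoid division. *)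
Lemma dot_Phi_comb (i : 'I_N) (r s : int) (y : 'I_N -> int) :
  let S := (\sum_i y i ^+ 2)%:~R in let t := (\sum_i y i)%:~R in
  N%:R * dot (Phi v r s (comb e y)) (Phi v r s (comb e y))
    = r%:~R ^+ 2 * (a + h) * (N%:R * S - t ^+ 2)
      + (r + s * N%:Z)%:~R ^+ 2 * t ^+ 2.
Proof.
move=> S t; rewrite dot_Phi dot_comb dot_comb_lagrangian -/S -/t.
rewrite rmorphD rmorphM /= -pmulrn.
have ->: a = 1 - h + h * N%:R by have := gram_lagrangian i; lra.
by ring.
Qed.

End Lagrangian.
End Combinations.

(** * The index of the image lattice *)

Lemma has_index_sublattice_rs {R : realType} {n : nat} (L : set 'rV[R]_n.+1) v e
    (r s m : int) : lagrangian_basis L v e -> r != 0 -> m != 0 ->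
    m = r + s * n.+1%:Z ->
  has_index L (sublattice_rs L v r s) (`|m| * `|r| ^ n)%N.
Proof.
move=> lagr_e r0 m0 mE; have [freee _] := lagrangian_zbasis lagr_e.
(* A coset is labelled by one residue modulo m and n residues modulo r. *)
have -> : (`|m| * `|r| ^ n)%N = #|{: 'I_`|m| * {ffun 'I_n -> 'I_`|r|}}|.
  by rewrite card_prod card_ffun !card_ord.
have ME x : sublattice_rs L v r s x <-> exists y, x = comb e (phi_coord r s y).
  rewrite /sublattice_rs (lagrangian_comb lagr_e); split.
    by move=> [_ [y _ <-] <-]; exists y; rewrite (Phi_comb lagr_e).
  move=> [y ->]; rewrite -(Phi_comb lagr_e).
  by exists (comb e y) => //; exists y.
pose rep (t : 'I_`|m| * {ffun 'I_n -> 'I_`|r|}) := comb e (coset_rep t).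
apply: (has_index_of_reps L _ _ rep).
- apply/ME; exists (fun=> 0); rewrite /comb big1 // => i _.
  by rewrite /phi_coord big1 // !mulr0.
- move=> _ _ /ME[y ->] /ME[z ->]; apply/ME; exists (fun i => y i - z i).
  by rewrite combB; apply: eq_comb => i; rewrite /phi_coord sumrB; ring.
- by move=> t; rewrite (lagrangian_comb lagr_e); exists (coset_rep t).
- move=> x; rewrite {1}(lagrangian_comb lagr_e) => -[y _ <-].
  have [t [z yE]] := coset_rep_exists r0 m0 mE y.
  exists t; apply/ME; exists z; rewrite combB; apply: eq_comb => i.
  by rewrite yE addrAC subrr add0r.
move=> t t' /ME[z /=]; rewrite combB => /(comb_inj _ _ _ freee) tt'.
by apply: (coset_rep_inj m0 mE _ _ z) => i; rewrite -tt' addrC subrK.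
Qed.

(* Here [n] is the dimension, [B = r^2 (a + h)], [M = m^2], [S] is the sum of
   the squared coordinates of a vector and [T] its squared coordinate sum. *)
Lemma gram_form_min {K : realFieldType} (n B M S T : K) : 0 < n ->
    M <= B * (n + 1) -> B <= M * (n + 1) -> 0 <= M ->
    (T = 0 /\ 2 <= S) \/ (1 <= T /\ T - 1 <= (n + 1) * (S - 1)) ->
  B * (n - 1) + M <= B * (n * S - T) + M * T.
Proof.
move=> n0 leMB leBM M0; have B0 : 0 <= B by nra.
case=> [[-> S2]|[T1 TS]].
  (* With T = 0 the difference of the two sides is B n (S - 2) + (B (n + 1) - M). *)
  have : 0 <= B * n * (S - 2) by rewrite !mulr_ge0 ?subr_ge0 // ltW.
  by move: leMB; lra.
(* Times n + 1, the difference is B n ((n + 1)(S - 1) - (T - 1)) + (T - 1)(M (n + 1) - B). *)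
rewrite -subr_ge0 -(pmulr_rge0 _ (_ : 0 < n + 1)); last by lra.
have := mulr_ge0 (_ : 0 <= T - 1) (_ : 0 <= M * (n + 1) - B).
have := mulr_ge0 (mulr_ge0 B0 (ltW n0)) (_ : 0 <= (n + 1) * (S - 1) - (T - 1)).
rewrite !subr_ge0 => /(_ TS) H1 /(_ T1 leBM) H2.
apply: le_trans (addr_ge0 H1 H2) _; rewrite le_eqVlt; apply/orP; left.
by apply/eqP; ring.
Qed.

(** * The minimum and the basis of minimal vectors *)

Theorem theorem4p9 (R : realType) (N : nat) (N_gt0 : (0 < N)%N)
    (L : set 'rV[R]_N) (v1 : 'rV[R]_N) (e : N.-tuple 'rV[R]_N)
    (tameL : tame L) (lagr_e : lagrangian_basis L v1 e)
    (r s m : int) (r_neq0 : r != 0) (r_ltN : `|r| < N%:Z)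
    (mE : m = r + s * N%:Z)
    (a h : R) (aE : a = dot e`_0 e`_0) (hE : h = - dot e`_0 e`_1)
    (lower : (N%:R * a - 1) / (N%:R ^+ 2 - 1) <= (m%:~R / r%:~R) ^+ 2)
    (upper : (m%:~R / r%:~R) ^+ 2
               <= (a * N%:R - 1) * (N%:R + 1) / (N%:R - 1)) :
  [/\ sublattice (sublattice_rs L v1 r s) L,
      has_index L (sublattice_rs L v1 r s) (`|m| * `|r| ^ N.-1)%N,
      is_lambda1 (sublattice_rs L v1 r s)
        (a * r%:~R ^+ 2 + (m%:~R ^+ 2 - r%:~R ^+ 2) / N%:R)
    & basis_of_minimal_vectors (sublattice_rs L v1 r s)
        [tuple tnth e i *~ r + v1 *~ s | i < N]].
Proof.
destruct N as [|[|n]] => //; first by lia.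
(* If m = 0, then N divides r, against 0 < |r| < N. *)
have m0 : m != 0.
  rewrite mE; have [|[|]] : s <= -1 \/ s = 0 \/ 1 <= s by lia.
  - by nia.
  - by lia.
  by nia.
have m0' : r + s * n.+2%:Z != 0 by rewrite -mE.
have diag i : dot (tnth e i) (tnth e i) = a.
  by rewrite aE -(tnth_nth _ _ ord0); apply: (lagrangian_diag lagr_e).
have offdiag i j : i != j -> dot (tnth e i) (tnth e j) = - h.
  rewrite hE opprK -(tnth_nth _ _ ord0) -(tnth_nth _ _ (lift ord0 ord0)) => ij.
  exact: (lagrangian_offdiag lagr_e).
have normE := dot_Phi_comb lagr_e diag offdiag ord0 r s.
have gramE := gram_lagrangian lagr_e diag offdiag ord0.
have n0 : 0 < n.+2%:R :> R by [].
have r2 : 0 < r%:~R ^+ 2 :> R by rewrite exprn_even_gt0 ?intr_eq0.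
(* This factorization cancels N - 1 in both hypotheses, which become [leM] and [leB]. *)
have aN : n.+2%:R * a - 1 = (a + h) * (n.+2%:R - 1) by move: gramE; nra.
have n1 : 0 < n.+2%:R - 1 :> R by rewrite subr_gt0 ltr1n.
have leM : m%:~R ^+ 2 <= r%:~R ^+ 2 * (a + h) * (n.+2%:R + 1) :> R.
  move: upper; rewrite expr_div_n (mulrC a) aN.
  rewrite [X in _ <= X]mulrAC mulfK ?gt_eqF //.
  by rewrite ler_pdivrMr // mulrAC (mulrC _ (r%:~R ^+ 2)).
have leB : r%:~R ^+ 2 * (a + h) <= m%:~R ^+ 2 * (n.+2%:R + 1) :> R.
  move: lower; rewrite aN -[X in _ ^+ 2 - X](expr1n _ 2) subr_sqr invfM mulrA.
  rewrite mulfK ?gt_eqF // expr_div_n ler_pdivrMr ?addr_gt0 // mulrAC.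
  by rewrite ler_pdivlMr // mulrC.
set l := a * _ + _.
(* The right side is the form of [dot_Phi_comb] at S = t = 1, its value on a coordinate vector. *)
have lE : n.+2%:R * l = r%:~R ^+ 2 * (a + h) * (n.+2%:R - 1) + m%:~R ^+ 2.
  rewrite /l mulrDr mulrA -[n.+2%:R * a](subrK 1) aN.
  by rewrite [X in _ + X = _]mulrCA divff ?gt_eqF // mulr1; ring.
have norm_basis i :
    dot (tnth (phi_basis e v1 r s) i) (tnth (phi_basis e v1 r s) i) = l.
  apply: (mulfI (lt0r_neq0 n0)).
  rewrite -comb_delta (comb_phi_basis lagr_e) normE lE -mE.
  have -> : \sum_j (j == i)%:Z = 1 :> int.
    by rewrite (bigD1 i) //= eqxx big1 ?addr0 // => j /negPf ->.
  have -> : \sum_j (j == i)%:Z ^+ 2 = 1 :> int.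
    by rewrite (bigD1 i) //= eqxx big1 ?addr0 // => j /negPf ->.
  by rewrite expr1n !mulr1.
have lb_l : lbound (sqnorms (sublattice_rs L v1 r s)) l.
  move=> w [u [[x]]]; rewrite (lagrangian_comb lagr_e) => -[y _ <-] <-.
  move=> /eqP Phi0 <-.
  have [i yi0] : exists i, y i != 0.
    apply/existsP; apply: contraNT Phi0 => /existsPn y0.
    rewrite (Phi_comb lagr_e) /comb big1 // => i _.
    have {}y0 j : y j = 0 by apply/eqP; rewrite -[_ == _]negbK y0.
    by rewrite /phi_coord big1 ?y0 ?mulr0.
  rewrite -(ler_pM2l n0) lE normE -mE.
  apply: gram_form_min => //.
  - by rewrite sqr_ge0.
  have [t0|t0] := eqVneq (\sum_j y j) 0.
    left; rewrite t0 expr0n; split=> //.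
    by have := sum_sqr_ge2 y i yi0 t0; rewrite -(ler_int R).
  right; split.
    by rewrite -rmorphXn /= (ler_int R 1) -gtz0_ge1 exprn_even_gt0.
  have := sqr_sum_sub1_le y i yi0.
  by rewrite -(ler_int R) !(rmorphB, rmorphD, rmorphM, rmorphXn) /= -pmulrn.
have basis_mem i : sublattice_rs L v1 r s (tnth (phi_basis e v1 r s) i).
  rewrite -comb_delta (comb_phi_basis lagr_e); eexists=> //.
  by rewrite (lagrangian_comb lagr_e); eexists.
have zfreeb : zfree (phi_basis e v1 r s) by apply: (zfree_phi_basis lagr_e).
have min_l : is_lambda1 (sublattice_rs L v1 r s) l.
  split=> //; exists (tnth (phi_basis e v1 r s) ord0) => //; split=> //.
  (* The vector is nonzero by freeness: its coordinate 0 is 1, that of the zero combination is 0. *)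
  rewrite -comb_delta -[X in _ <> X](_ : comb (phi_basis e v1 r s) (fun=> 0) = 0).
    by move=> /(comb_inj _ _ _ zfreeb)/(_ ord0).
  by rewrite /comb big1 // => i _; rewrite mulr0z.
split=> //.
- split; last exact: (sublattice_rs_sub lagr_e).
  exists (phi_basis e v1 r s); split; last exact: (sublattice_rsE lagr_e).
  by apply: (basis_of_phi_basis lagr_e) => //; case: tameL.
- exact: (has_index_sublattice_rs _ _ _ _ _ _ lagr_e).
split=> [|i]; first by split=> //; exact: (sublattice_rsE lagr_e).
by split; [exact: basis_mem|rewrite norm_basis].
Qed.
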